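(* Let $q$ be a power of a prime $p$ and let $k$ be an integer with $1\le k\le q+1$. If $p\mid k$, then $\mathcal B_{W_k^{\mathrm{Luc}}}=\varnothing$.
   Context: For nonnegative integers $i,k$ with base-$p$ expansions $i=\sum_r i_rp^r$, $k=\sum_r k_rp^r$ ($0\le i_r,k_r\le p-1$), write $i\le_p k$ if $i_r\le k_r$ for all $r$. $\mathbb F_q[X,Y]_k$ is the space of homogeneous polynomials of degree $k$ over $\mathbb F_q$. The Lucas subspace is $W_k^{\mathrm{Luc}}=\mathrm{span}_{\mathbb F_q}\{X^{k-i}Y^i:0\le i\le k,\ i\le_p k\}\subseteq\mathbb F_q[X,Y]_k$. $\mathbb P^1(\mathbb F_q)=\mathbb F_q\cup\{\infty\}$. For a $k$-subset $S\subseteq\mathbb P^1(\mathbb F_q)$, $F_S(X,Y)=\prod_{t\in S}(X-tY)$, where the factor for $t=\infty$ is taken to be $Y$. For a subspace $W\subseteq\mathbb F_q[X,Y]_k$, $\mathcal B_W=\{S\subseteq\mathbb P^1(\mathbb F_q): |S|=k,\ F_S\in W\}$. *)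

(* Defs.v *)
From HB Require Import structures.
From mathcomp Require Import all_boot all_algebra.
From mathcomp.multinomials Require Import mpoly.

Set Implicit Arguments.
Unset Strict Implicit.
Unset Printing Implicit Defensive.

Import GRing.Theory.

Local Open Scope ring_scope.

Definition digit (p r i : nat) : nat := ((i %/ p ^ r) %% p)%N.

(* Base-p digits of i at positions r > i vanish for 1 < p, so the bounded
   quantifier is the full digitwise order; see lucas_leP. *)
Definition lucas_le (p i k : nat) : bool :=
  [forall r : 'I_i.+1, (digit p r i <= digit p r k)%N].

Lemma lucas_leP (p i k : nat) : (1 < p)%N ->
  reflect (forall r : nat, (digit p r i <= digit p r k)%N) (lucas_le p i k).
Proof.
move=> p_gt1; apply: (iffP forallP) => [le_ik r | le_ik r]; last exact: le_ik.
have [lt_ri | le_ir] := ltnP r i.+1; first exact: (le_ik (Ordinal lt_ri)).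
by rewrite /digit divn_small ?mod0n // (ltn_trans le_ir) // ltn_expl.
Qed.

Section BinaryForms.

Variable F : finFieldType.

Notation X := ('X_ord0 : {mpoly F[2]}).
Notation Y := ('X_ord_max : {mpoly F[2]}).

(* The degree-k forms are dhomog 2 F k, and indhomog k f is f as an element
   of that space: f itself when f is homogeneous of degree k, and 0 otherwise.
   The value 0 never matters: see binary_monom_homog for the monomials with
   i <= k, and form_of_homog for the forms with #|S| = k. *)

Definition binary_monom (k i : nat) : {mpoly F[2]} := X ^+ (k - i) * Y ^+ i.

Lemma binary_monom_homog (k i : nat) : (i <= k)%N ->
  binary_monom k i \is k.-homog.
Proof.
move=> le_ik; rewrite -{2}(subnK le_ik).
by apply: dhomogM; rewrite -[X in X.-homog]mul1n; apply: dhomogMn;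
  rewrite dhomogX /= mdeg1.
Qed.

Definition lucas_space (p k : nat) : {vspace dhomog 2 F k} :=
  <<[seq indhomog k (binary_monom k i) | i <- iota 0 k.+1 & lucas_le p i k]>>%VS.

(* The projective line is option F, with None the point at infinity. *)
Definition point_form (t : option F) : {mpoly F[2]} :=
  if t is Some a then X - a *: Y else Y.

Definition form_of (S : {set option F}) : {mpoly F[2]} :=
  \prod_(t in S) point_form t.

Lemma form_of_homog (S : {set option F}) : form_of S \is #|S|.-homog.
Proof.
rewrite /form_of -sum1_card.
apply: (big_ind2 (fun (f : {mpoly F[2]}) d => f \is d.-homog)).
- exact: dhomog1.
- by move=> f d g e; apply: dhomogM.
case=> [a|] _; rewrite /point_form; last by rewrite dhomogX /= mdeg1.
by rewrite rpredB ?rpredZ // dhomogX /= mdeg1.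
Qed.

Definition blocks (k : nat) (W : {vspace dhomog 2 F k}) : {set {set option F}} :=
  [set S : {set option F} | (#|S| == k) && (indhomog k (form_of S) \in W)].

End BinaryForms.

(* Main.v *)
(* A form in the Lucas space has all X-exponents divisible by p once p | k, so
   its X-derivative vanishes. On the other hand F_S is squarefree, so at an
   affine root (a, 1) its X-derivative does not vanish; such a root exists
   because k >= p >= 2. *)
Require Import Defs.
From mathcomp Require Import all_boot all_algebra all_field.
From mathcomp.multinomials Require Import mpoly.

Import GRing.Theory.

Local Open Scope ring_scope.

(** Only position 0 matters: the units digit of [k] is 0, and it bounds that of [i]. *)
Lemma dvdn_lucas_le (p i k : nat) :
  (1 < p)%N -> (p %| k)%N -> lucas_le p i k -> (p %| i)%N.
Proof.
move=> p_gt1 p_k /(lucas_leP _ _ p_gt1)/(_ 0).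
by rewrite /digit expn0 !divn1 (eqP p_k) leqn0.
Qed.

Lemma mderiv_binary_monom (F : finFieldType) (p k i : nat) :
  p \in [pchar F] -> (p %| k - i)%N -> (binary_monom F k i)^`M(ord0) = 0.
Proof.
move=> pF p_ki; rewrite /binary_monom !mpolyXn -mpolyXD mderivX.
rewrite mnmDE !mulmnE !mnm1E !eqxx mul1n mul0n addn0.
by move: p_ki; rewrite (dvdn_pcharf pF) => /eqP->; rewrite scale0r.
Qed.

Lemma mderiv_lucas_space (F : finFieldType) (p k : nat)
    (f : dhomog 2 F k) :
  p \in [pchar F] -> (p %| k)%N -> f \in lucas_space F p k ->
  (val f)^`M(ord0) = 0.
Proof.
move=> pF p_k; rewrite /lucas_space; set s := map _ _.
move=> /(@coord_span _ _ _ (in_tuple s)) ->.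
rewrite raddf_sum raddf_sum big1 //= => j _; rewrite linearZ /=.
have /mapP[i] : s`_j \in s by rewrite mem_nth.
rewrite mem_filter mem_iota ltnS => /andP[le_ik ik] ->.
(* As [i <= k], [indhomog] yields the monomial itself rather than its default 0. *)
rewrite /indhomog insubdK; last exact: binary_monom_homog.
have p_gt1 : (1 < p)%N by apply/prime_gt1/(pcharf_prime pF).
rewrite (@mderiv_binary_monom _ p) ?scaler0 // dvdn_sub //.
exact: dvdn_lucas_le le_ik.
Qed.

(** At (a, 1) the factor X - aY vanishes, so the product rule leaves only its derivative 1 times the
    other factors. *)
Lemma mderiv_form_of_neq0 (F : finFieldType) (S : {set option F}) (a : F) :
  Some a \in S -> (form_of S)^`M(ord0) != 0.
Proof.
move=> aS; pose v (i : 'I_2) : F := if i == ord0 then a else 1.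
apply/eqP => /(congr1 (meval v)); rewrite /form_of (bigD1 (Some a)) //=.
rewrite mderivM mderivB mderivZ !mderivX !mnm1E /= scale0r scaler0 subr0.
(* Differentiating [X] leaves the monomial of exponent [U_(ord0) - U_(ord0)], which is 1. *)
rewrite scale1r -{1}[U_(ord0)%MM]addm0 addmC addmK mpolyX0 mul1r.
rewrite mevalD mevalM mevalB mevalZ !mevalXU /v /= mulr1 subrr mul0r addr0.
(* At (a, 1) another affine factor is a - b with b distinct from a, and the factor at infinity is
   1. *)
rewrite meval0 rmorph_prod; apply/eqP/prodf_neq0 => -[b|] /andP[_ neq_ba] /=.
  rewrite mevalB mevalZ !mevalXU /= mulr1 subr_eq0.
  by apply: contra neq_ba => /eqP->.
by rewrite mevalXU /= oner_eq0.
Qed.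

Theorem proposition8 (p e q k : nat) (F : finFieldType)
    (hp : prime p) (he : (0 < e)%N) (hq : q = (p ^ e)%N) (hF : #|F| = q)
    (hk1 : (1 <= k)%N) (hkq : (k <= q + 1)%N) (hpk : (p %| k)%N) :
  blocks (lucas_space F p k) = set0.
Proof.
have pF : p \in [pchar F] by apply: (@card_finPcharP _ _ e); rewrite ?hF.
apply/setP => S; rewrite !inE; apply/negP => /andP[/eqP cardS FS_lucas].
have [a aS | S_inf] := pickP (fun a => Some a \in S); last first.
  (* Without affine points [S] has at most one element, against [#|S| = k >= p >= 2]. *)
  have S1 : S \subset [set None] by apply/subsetP => -[a|]; rewrite inE ?S_inf.
  have := leq_trans (prime_gt1 hp) (dvdn_leq hk1 hpk).
  by rewrite -cardS ltnNge -(cards1 (@None F)) subset_leq_card.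
have := mderiv_lucas_space _ _ _ _ pF hpk FS_lucas.
rewrite /indhomog insubdK; last by rewrite -cardS; apply: form_of_homog.
exact/eqP/mderiv_form_of_neq0/aS.
Qed.
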